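(* There is a universal constant $c>0$ such that, if the standard deviation of the normal perturbation satisfies $\rho\le1$, the minimax risk of smoothed analysis for the uniform-weight spherical Gaussian mixture model with $k$ components in $\mathbb{R}^d$ and $n$ samples, $$R_{\rm minimax}:=\inf_{\widehat\theta}\ \sup_{\theta^*\in\Theta}\ \mathbb{E}_\theta\big[L(\widehat\theta(X),\theta)\big],\qquad L(\widehat\theta,\theta)=\|\widehat\theta-\theta\|_F^2,$$ is lower bounded by $$R_{\rm minimax}\ge c\,\frac{dk^2}{n}.$$
   Context: The parameter space $\Theta$ is the set of matrices $\theta^*=(\theta_1^*,\dots,\theta_k^* )\in\mathbb{R}^{d\times k}$ whose columns have mutual Euclidean distances at least $D$ (a given $D>0$). The number of components $k$ is assumed to be much smaller than $d$. Given $\theta^*\in\Theta$ chosen by the adversary, the true parameter $\theta\in\mathbb{R}^{d\times k}$ is generated by independent Gaussian perturbation of the entries: $\theta_{ij}\sim N(\theta^*_{ij};\rho^2)$. Given $\theta=(\theta_1,\dots,\theta_k)$, the data $X=(x_1,\dots,x_n)$ are i.i.d.: a membership $z_i$ is drawn uniformly from $\{1,\dots,k\}$ and then $x_i\sim N(\theta_{z_i};I_{d\times d})$; memberships are not observed. $\mathbb{E}_\theta$ is the expectation over the random perturbation producing $\theta$ and over the data $X$. The infimum is over all estimators $\widehat\theta$ mapping $X$ to $\mathbb{R}^{d\times k}$. $\|\cdot\|_F$ is the Frobenius norm. *)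

(* Defs.v *)
From HB Require Import structures.
From mathcomp Require Import all_boot all_order all_algebra.
From mathcomp Require Import all_classical all_reals all_analysis.

Set Implicit Arguments.
Unset Strict Implicit.
Unset Printing Implicit Defensive.

Import Order.TTheory GRing.Theory Num.Theory.

Local Open Scope classical_set_scope.
Local Open Scope ring_scope.

Section tuple_product.
Context {disp : measure_display} {T : measurableType disp} {R : realType}.

Definition tuple_cons n (x : T * n.-tuple T) : n.+1.-tuple T :=
  [tuple of x.1 :: x.2].

Lemma measurable_tuple_cons n : measurable_fun setT (@tuple_cons n).
Proof. exact: measurable_cons. Qed.

HB.instance Definition _ n :=
  isMeasurableFun.Build _ _ _ _ (@tuple_cons n) (@measurable_tuple_cons n).

(* The product P 0 \x ... \x P (n - 1) as a probability on n.-tuple T; see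
   tuple_prodE for its value on boxes. *)
Fixpoint tuple_prod n : ('I_n -> probability T R) -> probability (n.-tuple T) R :=
  match n with
  | 0 => fun=> \d_([tuple])
  | m.+1 => fun P =>
      distribution (P ord0 \x tuple_prod (fun i => P (lift ord0 i)))%E
                   (@tuple_cons m)
  end.

Lemma tuple_prodE n (P : 'I_n -> probability T R) (A : 'I_n -> set T) :
  (forall i, measurable (A i)) ->
  (tuple_prod P [set t | forall i, A i (tnth t i)] = \prod_(i < n) P i (A i))%E.
Proof.
elim: n P A => [|n IH] P A mA.
  rewrite big_ord0 /= diracE mem_set//= => -[].
  by [].
rewrite big_ord_recl -IH /=; last by move=> i; exact: mA.
rewrite /distribution /pushforward.
rewrite -product_measure1E//=; last first.
  have -> : [set t : n.-tuple T | forall i, A (lift ord0 i) (tnth t i)] =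
      \bigcap_(i in [set: 'I_n]) ((@tnth n T)^~ i @^-1` A (lift ord0 i)).
    by apply/seteqP; split => t /= h i; [move=> _; exact: h|exact: h].
  apply: fin_bigcap_measurable => // i _.
  by rewrite -[X in measurable X]setTI; exact: measurable_tnth.
congr ((_ \x _)%E _); apply/seteqP; split => -[x t] /=.
  move=> h; split; first exact: (h ord0).
  by move=> i; have := h (lift ord0 i); rewrite tnthS.
by move=> [hx ht] i; case: (unliftP ord0 i) => [j|] -> //; rewrite tnthS.
Qed.

End tuple_product.

Section gaussian_mixture.
Context {R : realType}.
Implicit Types d k n : nat.

(* A d x k matrix is given by the tuple of its k columns, tuples being the
   finite products that carry the product sigma-algebra:
   tnth (tnth theta j) i is the entry theta_ij. *)

(* normal_prob lives on measurableTypeR R, which has the same points and the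
   same measurable sets as R but another display: idTR only changes the type. *)
Definition idTR : measurableTypeR R -> R := idfun.

HB.instance Definition _ :=
  @isMeasurableFun.Build _ _ _ _ idTR (@measurable_id _ _ setT).

Definition normal_law (m s : R) : probability R R :=
  distribution (normal_prob m s) idTR.

Lemma normal_lawE (m s : R) (A : set R) : normal_law m s A = normal_prob m s A.
Proof. by []. Qed.

(* N(m; s^2 I) when s != 0; normal_prob _ 0 is not the degenerate law. *)
Definition gaussian d (m : d.-tuple R) (s : R) : probability (d.-tuple R) R :=
  tuple_prod (fun i => normal_law (tnth m i) s).

Definition eucl_dist d (u v : d.-tuple R) : R :=
  Num.sqrt (\sum_(i < d) (tnth u i - tnth v i) ^+ 2).

Definition separated d k (D : R) : set (k.-tuple (d.-tuple R)) :=
  [set theta | forall i j : 'I_k, i != j ->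
     D <= eucl_dist (tnth theta i) (tnth theta j)].

Definition perturbation d k (thetas : k.-tuple (d.-tuple R)) (rho : R) :
    probability (k.-tuple (d.-tuple R)) R :=
  tuple_prod (fun j => gaussian (tnth thetas j) rho).

Definition data_given d k n (theta : k.-tuple (d.-tuple R))
    (z : {ffun 'I_n -> 'I_k}) : probability (n.-tuple (d.-tuple R)) R :=
  tuple_prod (fun l => gaussian (tnth theta (z l)) 1).

(* The memberships z are i.i.d. uniform on 'I_k, i.e. uniform on
   {ffun 'I_n -> 'I_k}, which has k ^ n elements. *)
Definition expectation_mixture d k n (theta : k.-tuple (d.-tuple R))
    (f : n.-tuple (d.-tuple R) -> \bar R) : \bar R :=
  (((k ^ n)%:R^-1)%:E *
   \sum_(z : {ffun 'I_n -> 'I_k}) \int[data_given theta z]_X f X)%E.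

Definition frobenius_norm d k (a : k.-tuple (d.-tuple R)) : R :=
  Num.sqrt (\sum_(i < d) \sum_(j < k) tnth (tnth a j) i ^+ 2).

Definition tuple_sub d k (a b : k.-tuple (d.-tuple R)) :
    k.-tuple (d.-tuple R) :=
  [tuple [tuple tnth (tnth a j) i - tnth (tnth b j) i | i < d] | j < k].

Definition loss d k (a b : k.-tuple (d.-tuple R)) : R :=
  frobenius_norm (tuple_sub a b) ^+ 2.

Definition risk d k n (rho : R)
    (est : n.-tuple (d.-tuple R) -> k.-tuple (d.-tuple R))
    (thetas : k.-tuple (d.-tuple R)) : \bar R :=
  (\int[perturbation thetas rho]_theta
     expectation_mixture theta (fun X => (loss (est X) theta)%:E))%E.

Definition minimax_risk d k n (D rho : R) : \bar R :=
  ereal_inf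
    [set ereal_sup [set risk rho est thetas | thetas in separated D]
    | est in [set: {mfun n.-tuple (d.-tuple R) >-> k.-tuple (d.-tuple R)}]].

End gaussian_mixture.

Arguments minimax_risk {R}.

(* Main.v *)
Require Import Defs.
From mathcomp Require Import all_boot all_order all_algebra.
From mathcomp Require Import all_classical all_reals all_analysis.
From mathcomp Require Import measurable_realfun ring lra.

(** Assouad's argument on a hypercube of parameters. Put well separated centers
    at [theta] and let the entries of the [d x k] matrix move independently by
    [0] or [delta]; this gives [2 ^ (d k)] admissible matrices
    [cube_vertex theta delta v]. The supremum of the risk over the parameter
    space is at least its average over these vertices, and the squared
    Frobenius loss is the sum of the squared errors of the entries, so it is
    enough to bound, entry by entry, the error averaged over pairs of vertices
    which differ in that entry only.

    The perturbation does not help the estimator: the vertices of the cube are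
    translates of each other, hence so are their perturbations, and one noise
    matrix can be shared by all vertices. Conditionally on that noise the
    unperturbed problem is left, on a translated cube.

    Fix also the memberships [z]. Two vertices that differ by [delta] in an
    entry of column [j] give data laws [P] and [Q] which are products of
    Gaussians, differing only in the [n_j] samples drawn from component [j].
    With [M] the product of the Gaussians centered at the midpoints, the
    densities [p] and [q] of [P] and [Q] with respect to [M] satisfy
    [p q = exp (- n_j delta ^ 2 / 4)], identically. A constant product
    of densities is all that the two-point bound needs ([two_point_bound]), and
    it is multiplicative over products of measures ([overlap_tuple]). An
    estimator of the entry therefore has total squared error at least
    [delta ^ 2 / 2 * exp (- n_j delta ^ 2 / 4)] over the two vertices.

    Bounding [exp (- x)] below by [1 - x] makes the bound linear in the [n_j],
    which add up to [n] whatever [z] is; summing over the [d k] entries gives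
    [delta ^ 2 / 4 * d * (k - n delta ^ 2 / 4)], and [delta ^ 2 = 2 k / n]
    turns this into [d k ^ 2 / (4 n)]. So [c = 1 / 4] works. *)

Set Implicit Arguments.
Unset Strict Implicit.
Unset Printing Implicit Defensive.

Import Order.TTheory GRing.Theory Num.Theory numFieldNormedType.Exports.

Local Open Scope classical_set_scope.
Local Open Scope ring_scope.

(** * Densities of the normal law *)

Section density.
Context {R : realType}.

(** The Radon-Nikodym derivative of [nu] satisfies this identity, and it agrees
    almost everywhere with any other density of [nu]. *)
Lemma ge0_integral_density disp (T : measurableType disp)
    (nu : {finite_measure set T -> \bar R})
    (mu : {sigma_finite_measure set T -> \bar R}) (g : T -> R) (f : T -> \bar R) :
  measurable_fun setT g -> (forall x, 0 <= g x) ->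
  (forall A, measurable A -> nu A = \int[mu]_(x in A) (g x)%:E)%E ->
  measurable_fun setT f -> (forall x, 0 <= f x)%E ->
  (\int[nu]_x f x = \int[mu]_x (f x * (g x)%:E))%E.
Proof.
move=> mg g0 nuE mf f0.
have numu : nu `<< mu.
  apply/null_content_dominatesP => A mA muA0; rewrite nuE//.
  apply: null_set_integral => //.
  by apply/measurable_funTS/measurable_EFinP.
have mRN := measurable_int _ (Radon_Nikodym_SigmaFinite.f_integrable numu).
have mge : measurable_fun setT (fun x => (g x)%:E) by exact/measurable_EFinP.
rewrite -(Radon_Nikodym_SigmaFinite.change_of_variables numu f0)//.
apply: ge0_ae_eq_integral => //=.
- exact: emeasurable_funM.
- exact: emeasurable_funM.
- by move=> x _; rewrite mule_ge0// Radon_Nikodym_SigmaFinite.f_ge0.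
- by move=> x _; rewrite mule_ge0// lee_fin.
apply: ae_eqe_mul2l => /=.
apply: integral_ae_eq => //=.
  exact: Radon_Nikodym_SigmaFinite.f_integrable.
move=> A _ mA; rewrite -nuE//.
by rewrite -Radon_Nikodym_SigmaFinite.f_integral.
Qed.

Lemma integral_normal_law (m s : R) (f : R -> \bar R) :
  measurable_fun setT f -> (forall x, 0 <= f x)%E ->
  (\int[normal_law m s]_x f x =
   \int[lebesgue_measure]_x (f x * (normal_pdf m s x)%:E))%E.
Proof.
move=> mf f0; rewrite /normal_law ge0_integral_distribution//.
apply: ge0_integral_density => //; first exact: measurable_normal_pdf.
exact: normal_pdf_ge0.
Qed.

Lemma ge0_integral_translation (a : R) (f : R -> \bar R) :
  measurable_fun setT f -> (forall x, 0 <= f x)%E ->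
  (\int[lebesgue_measure]_x f x = \int[lebesgue_measure]_x f (x + a)%R)%E.
Proof.
move=> mf f0.
pose h : measurableTypeR R -> measurableTypeR R := fun x => x + a.
have mh : measurable_fun setT h by exact: measurable_funD.
transitivity (\int[pushforward lebesgue_measure h]_x f x)%E; last first.
  by rewrite ge0_integral_pushforward.
apply: eq_measure_integral => A mA _.
apply: lebesgue_measure_unique => //.
move=> _ [[u v]] _ <- /=; rewrite /pushforward.
have -> : h @^-1` `]u, v] = `]u - a, v - a]%classic.
  by apply/seteqP; split => x /=; rewrite !in_itv /= /h ltrBlDr lerBrDr.
rewrite !lebesgue_measure_itv/= !lte_fin ltrD2r.
by case: ifP => //; rewrite -!EFinB opprB addrA addrNK.
Qed.
End density.

(** * Changes of variables in product measures *)

Section weighted_pushforward.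
Context {R : realType}.

(** [P'] is the image by [phi] of the measure of density [r] with respect to [P].
    The two uses are a pure translation ([r = 1]) and a pure change of density
    ([phi = idfun]); both pass to products by the same induction. *)
Definition weighted_pushforward disp (T : measurableType disp)
    (P : probability T R) (phi : T -> T) (r : T -> R) (P' : probability T R) :=
  [/\ measurable_fun setT phi, measurable_fun setT r, (forall x, 0 <= r x) &
   forall f : T -> \bar R, measurable_fun setT f -> (forall x, 0 <= f x)%E ->
     (\int[P']_x f x = \int[P]_x (f (phi x) * (r x)%:E))%E].

Definition tuple_act n T (phi : 'I_n -> T -> T) (t : n.-tuple T) : n.-tuple T :=
  [tuple phi i (tnth t i) | i < n].

Lemma measurable_tuple_act disp (T : measurableType disp) n
    (phi : 'I_n -> T -> T) :
  (forall i, measurable_fun setT (phi i)) -> measurable_fun setT (tuple_act phi).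
Proof.
move=> mphi; apply/measurable_fun_tnthP => i.
have -> : (@tnth n T ^~ i) \o tuple_act phi = phi i \o (@tnth n T ^~ i).
  by apply/funext => t /=; rewrite tnth_mktuple.
by apply: measurableT_comp => //; exact: measurable_tnth.
Qed.

Lemma measurable_tuple_prod disp (T : measurableType disp) n
    (r : 'I_n -> T -> R) : (forall i, measurable_fun setT (r i)) ->
  measurable_fun setT (fun t : n.-tuple T => \prod_(i < n) r i (tnth t i)).
Proof.
move=> mr; apply: measurable_prod => i _.
by apply: (measurableT_comp (f := r i)) => //; exact: measurable_tnth.
Qed.

(** Induction on the number of factors: Tonelli isolates the first coordinate,
    to which the hypothesis on [P' ord0] is applied once the other coordinates
    have been integrated out. *)
Lemma weighted_pushforward_tuple disp (T : measurableType disp) n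
    (P P' : 'I_n -> probability T R) (phi : 'I_n -> T -> T)
    (r : 'I_n -> T -> R) :
  (forall i, weighted_pushforward (P i) (phi i) (r i) (P' i)) ->
  weighted_pushforward (tuple_prod P) (tuple_act phi)
    (fun t => \prod_(i < n) r i (tnth t i)) (tuple_prod P').
Proof.
move=> wP; split.
- exact: measurable_tuple_act (fun i => let: And4 m _ _ _ := wP i in m).
- exact: measurable_tuple_prod (fun i => let: And4 _ m _ _ := wP i in m).
- by move=> t; apply: prodr_ge0 => i _; case: (wP i).
suff : forall f : n.-tuple T -> \bar R,
    measurable_fun setT f -> (forall x, 0 <= f x)%E ->
    (\int[tuple_prod P']_x f x = \int[tuple_prod P]_x
      (f (tuple_act phi x) * (\prod_(i < n) r i (tnth x i))%:E))%E by [].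
elim: n => [|n IH] in P P' phi r wP *.
  move=> f mf f0 /=; apply: eq_integral => t _.
  by rewrite big_ord0 mule1; congr f; apply: eq_from_tnth => -[].
have [mphi0 mr0 r00 P'0E] := wP ord0.
pose phiS i := phi (lift ord0 i); pose rS i := r (lift ord0 i).
have wPS i : weighted_pushforward (P (lift ord0 i)) (phiS i) (rS i)
  (P' (lift ord0 i)) by exact: wP.
have := IH _ _ _ _ wPS => {}IH.
have mact : measurable_fun setT (tuple_act phiS).
  exact: measurable_tuple_act (fun i => let: And4 m _ _ _ := wPS i in m).
have mprod : measurable_fun setT
    (fun t : n.-tuple T => \prod_(i < n) rS i (tnth t i)).
  exact: measurable_tuple_prod (fun i => let: And4 _ m _ _ := wPS i in m).
have prod_ge0 (t : n.-tuple T) : 0 <= \prod_(i < n) rS i (tnth t i).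
  by apply: prodr_ge0 => i _; case: (wPS i).
have mcons := @measurable_tuple_cons _ T n.
move=> f mf f0 /=.
have mfact : measurable_fun setT (fun t : n.+1.-tuple T =>
    f (tuple_act phi t) * (\prod_(i < n.+1) r i (tnth t i))%:E)%E.
  apply: emeasurable_funM.
    apply: measurableT_comp => //.
    exact: measurable_tuple_act (fun i => let: And4 m _ _ _ := wP i in m).
  apply/measurable_EFinP.
  exact: measurable_tuple_prod (fun i => let: And4 _ m _ _ := wP i in m).
have fact_ge0 (t : n.+1.-tuple T) :
    (0 <= f (tuple_act phi t) * (\prod_(i < n.+1) r i (tnth t i))%:E)%E.
  by rewrite mule_ge0// lee_fin; apply: prodr_ge0 => i _; case: (wP i).
have actE x (t : n.-tuple T) : (f (tuple_act phi (tuple_cons (x, t))) *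
    (\prod_(i < n.+1) r i (tnth (tuple_cons (x, t)) i))%:E =
    f (tuple_cons (phi ord0 x, tuple_act phiS t)) *
    (\prod_(i < n) rS i (tnth t i))%:E * (r ord0 x)%:E)%E.
  rewrite -muleA -EFinM big_ord_recl [r ord0 _ * _]mulrC; congr (_ * _%:E)%E.
    congr f; apply: eq_from_tnth => i; rewrite tnth_mktuple.
    by case: (unliftP ord0 i) => [j|] ->//; rewrite !tnthS /= tnth_mktuple.
  by congr (_ * _); apply: eq_bigr => i _; rewrite tnthS.
have mfcons : measurable_fun setT (f \o @tuple_cons _ T n).
  exact: measurableT_comp.
rewrite ge0_integral_distribution// ge0_integral_distribution//.
rewrite fubini_tonelli1//; last by move=> x /=.
rewrite fubini_tonelli1//; last 2 first.
  exact: (measurableT_comp mfact mcons).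
  by move=> x /=.
rewrite P'0E//; last 2 first.
  by apply: measurable_fun_fubini_tonelli_F => // x /=.
  by move=> x; apply: integral_ge0 => t _ /=.
apply: eq_integral => x _; rewrite /fubini_F /= IH//; last first.
  exact: (measurable_fun_pair2 (f := f \o @tuple_cons _ T n)).
rewrite -ge0_integralZr//; last 3 first.
- apply: emeasurable_funM; last exact/measurable_EFinP.
  apply: (measurableT_comp (f := fun t => f (tuple_cons (phi ord0 x, t)))) => //.
  exact: (measurable_fun_pair2 (f := f \o @tuple_cons _ T n)).
- by move=> t _; rewrite mule_ge0// lee_fin.
- by rewrite lee_fin.
by apply: eq_integral => t _; rewrite actE.
Qed.
End weighted_pushforward.

(** * Translations of Gaussian laws *)

Section translation.
Context {R : realType}.

Lemma normal_pdf_gt0 (m s x : R) : s != 0 -> 0 < normal_pdf m s x.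
Proof.
by move=> s0; rewrite normal_pdfE// mulr_gt0 ?expR_gt0// normal_peak_gt0.
Qed.

(** Excluding [s = 0] matters: then [normal_prob m 0] is the uniform law on the
    unit interval for every [m]. *)
Lemma normal_law_translation (s m m' : R) : s != 0 ->
  weighted_pushforward (normal_law m s) (fun x => x + (m' - m)) (fun=> 1)
    (normal_law m' s).
Proof.
move=> s0.
have mt : measurable_fun setT (fun x : R => x + (m' - m)).
  exact: measurable_funD.
split; [exact: mt|exact: measurable_cst|by move=> x; exact: ler01|].
move=> f mf f0.
have mft : measurable_fun setT (fun x : R => f (x + (m' - m))).
  exact: measurableT_comp.
under [RHS]eq_integral do rewrite mule1.
transitivity (\int[lebesgue_measure]_x (f x * (normal_pdf m' s x)%:E))%E.
  exact: integral_normal_law.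
transitivity (\int[lebesgue_measure]_x
    (f (x + (m' - m))%R * (normal_pdf m s x)%:E))%E; last first.
  by apply/esym; exact: (integral_normal_law m s mft (fun x => f0 _)).
rewrite (ge0_integral_translation (m' - m)); first last.
- by move=> x; rewrite mule_ge0// lee_fin normal_pdf_ge0.
- apply: emeasurable_funM; first exact: mf.
  by apply/measurable_EFinP; exact: measurable_normal_pdf.
apply: eq_integral => x _; congr (_ * _%:E)%E.
rewrite (normal_pdfE m s0) (normal_pdfE m' s0) /normal_fun.
by have -> : x + (m' - m) - m' = x - m by ring.
Qed.

Definition tuple_shift d (a : 'I_d -> R) : d.-tuple R -> d.-tuple R :=
  tuple_act (fun i x => x + a i).

Lemma translation_tuple disp (T : measurableType disp) n
    (P P' : 'I_n -> probability T R) (phi : 'I_n -> T -> T) :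
  (forall i, weighted_pushforward (P i) (phi i) (fun=> 1) (P' i)) ->
  weighted_pushforward (tuple_prod P) (tuple_act phi) (fun=> 1) (tuple_prod P').
Proof.
move=> /weighted_pushforward_tuple.
by under [X in weighted_pushforward _ _ X]eq_fun do rewrite big1//.
Qed.

Lemma gaussian_translation d (s : R) (m m' : d.-tuple R) : s != 0 ->
  weighted_pushforward (gaussian m s) (tuple_shift (fun i => tnth m' i - tnth m i))
    (fun=> 1) (gaussian m' s).
Proof.
by move=> s0; apply: translation_tuple => i; exact: normal_law_translation.
Qed.

Lemma perturbation_translation d k (rho : R) (a b : k.-tuple (d.-tuple R)) :
  rho != 0 ->
  weighted_pushforward (perturbation a rho)
    (tuple_act (fun j => tuple_shift
      (fun i => tnth (tnth b j) i - tnth (tnth a j) i)))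
    (fun=> 1) (perturbation b rho).
Proof.
by move=> s0; apply: translation_tuple => j; exact: gaussian_translation.
Qed.

(** Data under [b] are data under [a] with the noise kept and the centers moved.
    Fixing [a] yields a law that no longer depends on the parameter, which is
    how measurability in the parameter is obtained below. *)
Lemma data_translation d k n (a b : k.-tuple (d.-tuple R))
    (z : {ffun 'I_n -> 'I_k}) :
  weighted_pushforward (data_given a z)
    (tuple_act (fun l => tuple_shift
      (fun i => tnth (tnth b (z l)) i - tnth (tnth a (z l)) i)))
    (fun=> 1) (data_given b z).
Proof.
by apply: translation_tuple => l; exact: gaussian_translation.
Qed.
End translation.

(** * Overlapping laws and the two-point bound *)

Section overlap.
Context {R : realType}.

(** [P] and [Q] have positive densities with respect to [M] whose product is the
    constant [q]. Then [q] is the square of the Hellinger affinity of [P] and [Q],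
    and [M] is proportional to their geometric mean. *)
Definition overlap disp (T : measurableType disp) (q : R)
    (M P Q : probability T R) :=
  exists r : T -> R, [/\ forall x, 0 < r x,
    weighted_pushforward M idfun r P &
    weighted_pushforward M idfun (fun x => q / r x) Q].

Lemma tuple_act_id n T : tuple_act (fun=> idfun) = idfun :> (n.-tuple T -> n.-tuple T).
Proof.
by apply/funext => t; apply: eq_from_tnth => i; rewrite tnth_mktuple.
Qed.

(** The densities and their constant product multiply over the factors. *)
Lemma overlap_tuple disp (T : measurableType disp) n (q : 'I_n -> R)
    (M P Q : 'I_n -> probability T R) :
  (forall i, overlap (q i) (M i) (P i) (Q i)) ->
  overlap (\prod_(i < n) q i) (tuple_prod M) (tuple_prod P) (tuple_prod Q).
Proof.
move=> /choice[r rP]; exists (fun t => \prod_(i < n) r i (tnth t i)).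
rewrite -tuple_act_id; split.
- by move=> t; apply: prodr_gt0 => i _; case: (rP i).
- by apply: weighted_pushforward_tuple => i; case: (rP i).
under [X in weighted_pushforward _ _ X]eq_fun do rewrite -prodf_div.
by apply: (weighted_pushforward_tuple (r := fun i x => q i / r i x)) => i;
  case: (rP i).
Qed.

Lemma normal_law_density (m u : R) :
  weighted_pushforward (normal_law m 1) idfun
    (fun x => normal_pdf u 1 x / normal_pdf m 1 x) (normal_law u 1).
Proof.
have mm : measurable_fun setT (fun x : R => normal_pdf u 1 x / normal_pdf m 1 x).
  have m1 := oner_neq0 R; apply: continuous_measurable_fun => x.
  apply: continuousM; first exact: continuous_normal_pdf.
  apply: continuousV; last exact: continuous_normal_pdf.
  by rewrite gt_eqF// normal_pdf_gt0.
have p0 x : 0 <= normal_pdf u 1 x / normal_pdf m 1 x.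
  by rewrite divr_ge0// normal_pdf_ge0.
split; [exact: measurable_id|exact: mm|exact: p0|].
move=> f mf f0.
have mfr : measurable_fun setT
    (fun x => f x * (normal_pdf u 1 x / normal_pdf m 1 x)%:E)%E.
  by apply: emeasurable_funM; [exact: mf|apply/measurable_EFinP; exact: mm].
transitivity (\int[lebesgue_measure]_x (f x * (normal_pdf u 1 x)%:E))%E.
  exact: integral_normal_law.
transitivity (\int[lebesgue_measure]_x
    (f x * (normal_pdf u 1 x / normal_pdf m 1 x)%:E * (normal_pdf m 1 x)%:E))%E.
  apply: eq_integral => x _; rewrite -muleA -EFinM mulfVK//.
  by rewrite gt_eqF// normal_pdf_gt0// oner_eq0.
apply/esym; apply: (integral_normal_law m 1 mfr) => x.
by rewrite mule_ge0 ?lee_fin ?p0 ?f0.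
Qed.

(** The product of two Gaussian densities of the same variance is, up to a
    constant factor, the square of the density centered at the midpoint. *)
Lemma overlap_normal (u v : R) :
  overlap (expR (- ((u - v) ^+ 2 / 4))) (normal_law ((u + v) / 2) 1)
    (normal_law u 1) (normal_law v 1).
Proof.
set m := (u + v) / 2.
have p_gt0 a x : 0 < normal_pdf a 1 x :> R by rewrite normal_pdf_gt0// oner_eq0.
exists (fun x => normal_pdf u 1 x / normal_pdf m 1 x).
split; [by move=> x; rewrite divr_gt0|exact: normal_law_density|].
rewrite (_ : (fun x => _) = (fun x => normal_pdf v 1 x / normal_pdf m 1 x)).
  exact: normal_law_density.
apply/funext => x; rewrite invf_div mulrA.
have [pm pu] := (p_gt0 m x, p_gt0 u x).
apply/eqP; rewrite eqr_div ?lt0r_neq0//; apply/eqP.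
rewrite !normal_pdfE ?oner_eq0// /normal_fun.
set c := normal_peak 1.
rewrite [LHS](_ : _ = c ^+ 2 * (expR (- ((u - v) ^+ 2 / 4)) *
  (expR (- (x - m) ^+ 2 / (1 ^+ 2 *+ 2)) *
   expR (- (x - m) ^+ 2 / (1 ^+ 2 *+ 2))))); last by ring.
rewrite [RHS](_ : _ = c ^+ 2 * (expR (- (x - v) ^+ 2 / (1 ^+ 2 *+ 2)) *
   expR (- (x - u) ^+ 2 / (1 ^+ 2 *+ 2)))); last by ring.
rewrite -!expRD; congr (_ * expR _); rewrite /m.
by field.
Qed.

Lemma overlap_gaussian d (u v : d.-tuple R) :
  overlap (expR (- ((\sum_(i < d) (tnth u i - tnth v i) ^+ 2) / 4)))
    (gaussian [tuple (tnth u i + tnth v i) / 2 | i < d] 1)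
    (gaussian u 1) (gaussian v 1).
Proof.
rewrite mulr_suml -sumrN expR_sum; apply: overlap_tuple => i.
rewrite tnth_mktuple; exact: overlap_normal.
Qed.

Lemma overlap_data d k n (a b : k.-tuple (d.-tuple R)) (z : {ffun 'I_n -> 'I_k}) :
  exists M, overlap
    (expR (- ((\sum_(l < n) \sum_(i < d)
      (tnth (tnth a (z l)) i - tnth (tnth b (z l)) i) ^+ 2) / 4)))
    M (data_given a z) (data_given b z).
Proof.
eexists; rewrite mulr_suml -sumrN expR_sum; apply: overlap_tuple => l.
exact: overlap_gaussian.
Qed.

(** Le Cam's bound for the quadratic loss. With densities [t] and [s] for which
    [s * t = q], Cauchy-Schwarz gives
    [(y - a) ^ 2 * t + (y - b) ^ 2 * s >= (a - b) ^ 2 * q / (t + s)]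
    for every estimate [y], and [1 / w >= 1 - w / 4] at [w = t + s] makes the
    lower bound affine in the densities, which integrate to one. The constant
    [c = (a - b) ^ 2 * q / 4] is the slope; adding it to both squared errors
    keeps all the integrands nonnegative. *)
Lemma two_point_bound disp (T : measurableType disp) (q : R) (M P Q : probability T R)
    (g : T -> R) (a b : R) : 0 <= q ->
  overlap q M P Q -> measurable_fun setT g ->
  (((a - b) ^+ 2 / 2 * q)%:E <=
   \int[P]_x ((g x - a) ^+ 2)%:E + \int[Q]_x ((g x - b) ^+ 2)%:E)%E.
Proof.
move=> q0 [r [r0 [_ mr _ PE] [_ mqr _ QE]]] mg.
pose c := (a - b) ^+ 2 * q / 4.
have c0 : 0 <= c by rewrite /c divr_ge0// mulr_ge0// sqr_ge0.
have msq y : measurable_fun setT (fun x => (g x - y) ^+ 2).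
  by apply: measurable_funX; exact: measurable_funB.
have mint y : measurable_fun setT (fun x => ((g x - y) ^+ 2 + c)%:E).
  by apply/measurable_EFinP; exact: measurable_funD.
have int0 y x : (0 <= ((g x - y) ^+ 2 + c)%:E)%E.
  by rewrite lee_fin addr_ge0// sqr_ge0.
have addc (N : probability T R) y : (\int[N]_x ((g x - y) ^+ 2 + c)%:E =
    \int[N]_x ((g x - y) ^+ 2)%:E + c%:E)%E.
  under eq_integral do rewrite EFinD.
  rewrite ge0_integralD//.
  - by rewrite integral_cst//= probability_setT mule1.
  - by move=> x _; rewrite lee_fin sqr_ge0.
  - exact/measurable_EFinP.
suff : (((a - b) ^+ 2 * q)%:E <= \int[P]_x ((g x - a) ^+ 2 + c)%:E +
    \int[Q]_x ((g x - b) ^+ 2 + c)%:E)%E.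
  rewrite !addc addeACA -EFinD -leeBlDr// -EFinB; apply: le_trans.
  by rewrite lee_fin /c; lra.
rewrite PE// QE// -ge0_integralD//.
- rewrite -[leLHS]mule1 -(@probability_setT _ _ _ M) -integral_cst//.
  apply: ge0_le_integral => //.
  + by move=> x _; rewrite lee_fin mulr_ge0// sqr_ge0.
  + by apply: emeasurable_funD; apply: emeasurable_funM => //;
      exact/measurable_EFinP.
  move=> x _ /=; rewrite -!EFinM -EFinD lee_fin /c.
  have := r0 x; move: (g x) (r x) => y t t0.
  have s0 : 0 <= q / t by rewrite divr_ge0// ltW.
  have := divfK (lt0r_neq0 t0) q; move: (q / t) s0 => s s0 <-.
  have w0 : 0 < t + s by rewrite ltr_wpDr.
  rewrite -subr_ge0 -(pmulr_lge0 _ w0).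
  (* The excess over the bound, multiplied by [t + s], is a sum of two squares:
     the defect in Cauchy-Schwarz and the one in [1 / w >= 1 - w / 4]. *)
  rewrite [leRHS](_ : _ = ((y - a) * t + (y - b) * s) ^+ 2 +
      (a - b) ^+ 2 * (s * t) * (1 - (t + s) / 2) ^+ 2); last by field.
  apply: addr_ge0; first exact: sqr_ge0.
  apply: mulr_ge0; last exact: sqr_ge0.
  by apply: mulr_ge0; [exact: sqr_ge0|rewrite mulr_ge0// ltW].
- by move=> x _; rewrite mule_ge0// lee_fin ltW.
- by apply: emeasurable_funM => //; exact/measurable_EFinP.
- by move=> x _; rewrite mule_ge0// lee_fin divr_ge0// ltW.
- by apply: emeasurable_funM => //; exact/measurable_EFinP.
Qed.
End overlap.

(** * The hypercube of parameters *)

Section cube.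
Context {R : realType}.
Implicit Types d k n : nat.

Definition entry d k (a : k.-tuple (d.-tuple R)) (p : 'I_k * 'I_d) : R :=
  tnth (tnth a p.1) p.2.

Lemma lossE d k (a b : k.-tuple (d.-tuple R)) :
  loss a b = \sum_p (entry a p - entry b p) ^+ 2.
Proof.
rewrite /loss /frobenius_norm sqr_sqrtr; last first.
  by apply: sumr_ge0 => i _; apply: sumr_ge0 => j _; exact: sqr_ge0.
rewrite exchange_big pair_big /=; apply: eq_bigr => p _.
by rewrite !tnth_mktuple.
Qed.

Lemma measurable_entry d k (p : 'I_k * 'I_d) :
  measurable_fun setT (fun a : k.-tuple (d.-tuple R) => entry a p).
Proof.
apply: (measurableT_comp (f := fun c : d.-tuple R => tnth c p.2)).
  exact: measurable_tnth.
exact: measurable_tnth.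
Qed.

Lemma measurable_entry_comp disp (T : measurableType disp) d k
    (h : T -> k.-tuple (d.-tuple R)) (p : 'I_k * 'I_d) :
  measurable_fun setT h -> measurable_fun setT (fun x => entry (h x) p).
Proof.
by move=> mh; exact: (measurableT_comp (measurable_entry p) mh).
Qed.

Lemma measurable_loss d k n
    (est : n.-tuple (d.-tuple R) -> k.-tuple (d.-tuple R)) :
  measurable_fun setT est ->
  measurable_fun setT
    (fun x : (k.-tuple (d.-tuple R)) * n.-tuple (d.-tuple R) =>
      (loss (est x.2) x.1)%:E).
Proof.
move=> mest; apply/measurable_EFinP.
under eq_fun do rewrite lossE.
apply: measurable_sum => p; apply/measurable_funX/measurable_funB.
  by apply: measurable_entry_comp; exact: (measurableT_comp mest).
exact: measurable_entry_comp.
Qed.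

(** The law of the data depends on the parameter. Translating it to the law of
    the data for zero centers moves this dependence into the integrand, where
    Tonelli's theorem applies. *)
Lemma measurable_expectation_mixture d k n
    (f : (k.-tuple (d.-tuple R)) * n.-tuple (d.-tuple R) -> \bar R) :
  measurable_fun setT f -> (forall x, 0 <= f x)%E ->
  measurable_fun setT
    (fun theta => expectation_mixture theta (fun X => f (theta, X))).
Proof.
move=> mf f0.
apply: emeasurable_funM; first exact: measurable_cst.
apply: emeasurable_sum => z.
pose o : k.-tuple (d.-tuple R) := [tuple [tuple 0 | i < d] | j < k].
pose h (x : (k.-tuple (d.-tuple R)) * n.-tuple (d.-tuple R)) :=
  f (x.1, tuple_act (fun l => tuple_shift
    (fun i => tnth (tnth x.1 (z l)) i - tnth (tnth o (z l)) i)) x.2).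
have mh : measurable_fun setT h.
  apply: (measurableT_comp mf); apply: measurable_fun_pair => //.
  apply/measurable_fun_tnthP => l; apply/measurable_fun_tnthP => i.
  rewrite (_ : _ \o _ = fun x => entry x.2 (l, i) +
      (entry x.1 (z l, i) - entry o (z l, i))); last first.
    by apply/funext => x /=; rewrite 2!tnth_mktuple.
  apply: measurable_funD; first exact: measurable_entry_comp.
  apply: measurable_funB; last exact: measurable_cst.
  exact: measurable_entry_comp.
rewrite (_ : (fun _ => _) = fubini_F (data_given o z) h); last first.
  apply/funext => theta; have [_ _ _ ->] := data_translation o theta z.
  - by apply: eq_integral => X _; rewrite mule1.
  - exact: (measurable_fun_pair2 (f := f)).
  - by move=> X; exact: f0.
by apply: measurable_fun_fubini_tonelli_F; [exact: mh|move=> x; exact: f0].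
Qed.

Definition cube_vertex d k (theta : k.-tuple (d.-tuple R)) (delta : R)
    (v : {ffun 'I_k * 'I_d -> bool}) : k.-tuple (d.-tuple R) :=
  tuple_act (fun j => tuple_shift (fun i => delta * (v (j, i))%:R)) theta.

Lemma entry_cube_vertex d k (theta : k.-tuple (d.-tuple R)) (delta : R) v p :
  entry (cube_vertex theta delta v) p = entry theta p + delta * (v p)%:R.
Proof. by case: p => j i; rewrite /entry !tnth_mktuple. Qed.

Definition flip (T : finType) (p : T) (v : {ffun T -> bool}) : {ffun T -> bool} :=
  [ffun q => (q == p) (+) v q].

Lemma flipK (T : finType) (p : T) : involutive (flip p).
Proof. by move=> v; apply/ffunP => q; rewrite !ffunE addbA addbb. Qed.

Lemma cube_vertex_flip d k (theta : k.-tuple (d.-tuple R)) (delta : R) v p q :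
  (entry (cube_vertex theta delta v) q -
   entry (cube_vertex theta delta (flip p v)) q) ^+ 2 =
  delta ^+ 2 *+ (q == p).
Proof.
rewrite !entry_cube_vertex ffunE.
by case: (q == p); case: (v q) => /=; rewrite ?mulr1n ?mulr0n; ring.
Qed.

Definition entry_risk d k n
    (est : n.-tuple (d.-tuple R) -> k.-tuple (d.-tuple R))
    (z : {ffun 'I_n -> 'I_k}) (p : 'I_k * 'I_d)
    (theta : k.-tuple (d.-tuple R)) : \bar R :=
  (\int[data_given theta z]_X ((entry (est X) p - entry theta p) ^+ 2)%:E)%E.

(** Two vertices of the cube which differ in the entry [p]: the squared distance
    between their centers, summed over the samples, is [delta ^ 2] times the number
    of samples drawn from the column [p.1]. *)
Lemma two_point_entry d k n (theta : k.-tuple (d.-tuple R)) (delta : R) v p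
    (est : n.-tuple (d.-tuple R) -> k.-tuple (d.-tuple R))
    (z : {ffun 'I_n -> 'I_k}) :
  measurable_fun setT est ->
  ((delta ^+ 2 / 2 * (1 - delta ^+ 2 / 4 * \sum_(l < n) (z l == p.1)%:R))%:E <=
   entry_risk est z p (cube_vertex theta delta v) +
   entry_risk est z p (cube_vertex theta delta (flip p v)))%E.
Proof.
move=> mest.
have [M PQ] := overlap_data (cube_vertex theta delta v)
  (cube_vertex theta delta (flip p v)) z.
have mg := measurable_entry_comp p mest.
have := two_point_bound (entry (cube_vertex theta delta v) p)
  (entry (cube_vertex theta delta (flip p v)) p) (expR_ge0 _) PQ mg.
apply: le_trans; rewrite lee_fin cube_vertex_flip eqxx mulr1n.
rewrite ler_wpM2l ?divr_ge0 ?sqr_ge0//.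
apply: le_trans (expR_ge1Dx _); rewrite lerD2l lerN2.
rewrite [leRHS]mulrAC ler_wpM2r// mulr_sumr; apply: ler_sum => l _.
rewrite (eq_bigr (fun i => delta ^+ 2 *+ ((z l, i) == p))); last first.
  by move=> i _; rewrite -(cube_vertex_flip theta delta v).
rewrite (bigD1 p.2)//= big1 ?addr0; last first.
  by move=> i ip; rewrite -pair_eqE /pair_eq /= (negbTE ip) andbF.
by rewrite -pair_eqE /pair_eq /= eqxx andbT mulr_natr.
Qed.

(** Pairing each vertex with its neighbour across [p] counts every vertex twice,
    whence the doubling in the proof. Every sample belongs to one component, so
    the sizes of the components add up to [n] for each [z]. *)
Lemma sum_cube_loss d k n (theta : k.-tuple (d.-tuple R)) (delta : R)
    (est : n.-tuple (d.-tuple R) -> k.-tuple (d.-tuple R))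
    (z : {ffun 'I_n -> 'I_k}) :
  measurable_fun setT est ->
  ((#|{ffun 'I_k * 'I_d -> bool}|%:R *
     (delta ^+ 2 / 4 * d%:R * (k%:R - delta ^+ 2 / 4 * n%:R)))%:E <=
   \sum_v \int[data_given (cube_vertex theta delta v) z]_X
      (loss (est X) (cube_vertex theta delta v))%:E)%E.
Proof.
move=> mest.
pose err p v : \bar R := entry_risk est z p (cube_vertex theta delta v).
have -> : (\sum_v \int[data_given (cube_vertex theta delta v) z]_X
      (loss (est X) (cube_vertex theta delta v))%:E = \sum_p \sum_v err p v)%E.
  rewrite exchange_big; apply: eq_bigr => v _.
  under eq_integral do rewrite lossE -sumEFin.
  rewrite ge0_integral_sum; first by [].
  - exact: measurableT.
  - move=> p; apply/measurable_EFinP/measurable_funX/measurable_funB.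
      exact: measurable_entry_comp.
    exact: measurable_cst.
  - by move=> p X _; rewrite lee_fin sqr_ge0.
have two p v : ((delta ^+ 2 / 2 *
    (1 - delta ^+ 2 / 4 * \sum_(l < n) (z l == p.1)%:R))%:E <=
    err p v + err p (flip p v))%E by exact: two_point_entry.
clearbody err; rewrite -(@lee_pmul2l _ 2%:E)// [leRHS]mule_natl [leRHS]mule2n.
rewrite -big_split/= [leRHS](eq_bigr
    (fun p => \sum_v (err p v + err p (flip p v))))%E; last first.
  move=> p _; rewrite big_split/=; congr (_ + _)%E.
  by rewrite (reindex_inj (inv_inj (flipK p))).
apply: (le_trans _ (lee_sum _ (fun p _ => lee_sum _ (fun v _ => two p v)))).
under eq_bigr do rewrite sumEFin sumr_const.
rewrite sumEFin -EFinM lee_fin sumrMnl -mulr_sumr big_split/= sumr_const.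
rewrite sumrN -mulr_sumr -(pair_bigA _ (fun j _ => \sum_(l < n) (z l == j)%:R)) /=.
under eq_bigr do rewrite sumr_const.
rewrite sumrMnl exchange_big /=.
have -> : \sum_(l < n) \sum_(j < k) (z l == j)%:R = n%:R :> R.
  rewrite (eq_bigr (fun=> 1)) ?sumr_const ?card_ord// => l _.
  by rewrite (bigD1 (z l))//= eqxx big1 ?addr0// => j; rewrite eq_sym => /negbTE->.
move: #|{ffun 'I_k * 'I_d -> bool}| => N.
rewrite card_prod !card_ord -[_ *+ N]mulr_natr -[_ *+ d]mulr_natr natrM.
by rewrite le_eqVlt; apply/orP; left; apply/eqP; field.
Qed.

Lemma sum_cube_mixture d k n (theta : k.-tuple (d.-tuple R)) (delta : R)
    (est : n.-tuple (d.-tuple R) -> k.-tuple (d.-tuple R)) :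
  (0 < k)%N -> measurable_fun setT est ->
  ((#|{ffun 'I_k * 'I_d -> bool}|%:R *
     (delta ^+ 2 / 4 * d%:R * (k%:R - delta ^+ 2 / 4 * n%:R)))%:E <=
   \sum_v expectation_mixture (cube_vertex theta delta v)
      (fun X => (loss (est X) (cube_vertex theta delta v))%:E))%E.
Proof.
move=> k0 mest; pose err (z : {ffun 'I_n -> 'I_k}) v : \bar R :=
  (\int[data_given (cube_vertex theta delta v) z]_X
      (loss (est X) (cube_vertex theta delta v))%:E)%E.
have err0 z v : (0 <= err z v)%E.
  by apply: integral_ge0 => X _; rewrite lee_fin sqr_ge0.
set B := (_ * _)%R.
have errB z : (B%:E <= \sum_v err z v)%E by exact: sum_cube_loss.
rewrite (_ : (\sum_v _ = \sum_v ((k ^ n)%:R^-1%:E * \sum_z err z v))%E)//.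
clearbody err.
have kn0 : 0 < (k ^ n)%:R :> R by rewrite ltr0n expn_gt0 k0.
rewrite -ge0_sume_distrr/=; last by move=> v _; exact: sume_ge0.
rewrite exchange_big /= -(@lee_pmul2l _ (k ^ n)%:R%:E)//.
rewrite [leRHS]muleA -(EFinM (k ^ n)%:R (k ^ n)%:R^-1) mulfV ?lt0r_neq0//.
rewrite [leRHS]mul1e.
apply: (le_trans _ (lee_sum _ (fun z _ => errB z))).
by rewrite sumEFin sumr_const card_ffun !card_ord -EFinM mulr_natl.
Qed.

(** All the perturbed vertices are written over the noise of the base point
    [theta]; for each value of it the unperturbed bound holds on the cube that
    starts at the perturbed point. *)
Lemma sum_cube_risk d k n (theta : k.-tuple (d.-tuple R)) (delta rho : R)
    (est : n.-tuple (d.-tuple R) -> k.-tuple (d.-tuple R)) :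
  (0 < k)%N -> rho != 0 -> measurable_fun setT est ->
  0 <= delta ^+ 2 / 4 * d%:R * (k%:R - delta ^+ 2 / 4 * n%:R) ->
  ((#|{ffun 'I_k * 'I_d -> bool}|%:R *
     (delta ^+ 2 / 4 * d%:R * (k%:R - delta ^+ 2 / 4 * n%:R)))%:E <=
   \sum_v risk rho est (cube_vertex theta delta v))%E.
Proof.
move=> k0 rho0 mest B0.
pose E (a : k.-tuple (d.-tuple R)) : \bar R :=
  expectation_mixture a (fun X => (loss (est X) a)%:E).
have E0 a : (0 <= E a)%E.
  apply: mule_ge0; first by rewrite lee_fin invr_ge0.
  by apply: sume_ge0 => z _; apply: integral_ge0 => X _; rewrite lee_fin sqr_ge0.
have mE : measurable_fun setT E.
  apply: (measurable_expectation_mixture (f := fun x => (loss (est x.2) x.1)%:E)).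
    exact: measurable_loss.
  by move=> x; rewrite lee_fin sqr_ge0.
have mEv v : measurable_fun setT (fun a => E (cube_vertex a delta v)).
  apply: (measurableT_comp mE); apply: measurable_tuple_act => j.
  by apply: measurable_tuple_act => i; exact: measurable_funD.
have riskE v : (risk rho est (cube_vertex theta delta v) =
    \int[perturbation theta rho]_a E (cube_vertex a delta v))%E.
  rewrite /risk -/(E _).
  have [_ _ _ intE] :=
    perturbation_translation theta (cube_vertex theta delta v) rho0.
  apply: etrans (intE _ mE E0) _.
  apply: eq_integral => a _; rewrite mule1; congr E.
  apply: eq_from_tnth => j; apply: eq_from_tnth => i.
  by rewrite !tnth_mktuple addrAC subrr add0r.
set B := (_ * _)%R.
have EB a : (B%:E <= \sum_v E (cube_vertex a delta v))%E.
  exact: sum_cube_mixture.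
clearbody E.
under eq_bigr do rewrite riskE.
rewrite -ge0_integral_sum; [|exact: measurableT|exact: mEv|by move=> v a _; exact: E0].
rewrite -[leLHS]mule1 -(@probability_setT _ _ _ (perturbation theta rho)).
rewrite -integral_cst; last exact: measurableT.
apply: ge0_le_integral.
- exact: measurableT.
- by move=> a _; rewrite lee_fin mulr_ge0.
- exact: measurable_cst.
- exact: emeasurable_sum.
- move=> a _. exact: EB.
Qed.
End cube.

(** * Separated centers and the lower bound *)

Lemma le_eucl_dist (R : realType) d (u v : d.-tuple R) i :
  `|tnth u i - tnth v i| <= eucl_dist u v.
Proof.
rewrite -sqrtr_sqr ler_wsqrtr// (bigD1 i)//= lerDl.
by apply: sumr_ge0 => j _; exact: sqr_ge0.
Qed.

Definition spread_centers {R : realType} d k (s : R) : k.-tuple (d.-tuple R) :=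
  [tuple [tuple j%:R * s | i < d] | j < k].

(** Consecutive base centers differ by [D + delta] in every coordinate and a
    vertex moves an entry by at most [delta], so the first coordinate alone
    keeps the centers at distance [D]. *)
Lemma separated_cube (R : realType) d k (D delta : R) v :
  (0 < d)%N -> 0 <= D -> 0 <= delta ->
  Defs.separated D (cube_vertex (spread_centers d k (D + delta)) delta v).
Proof.
case: d v => // d v _ D0 delta0 /=.
have far (i j : 'I_k) : (i < j)%N ->
    D <= `|entry (cube_vertex (spread_centers d.+1 k (D + delta)) delta v) (j, ord0) -
           entry (cube_vertex (spread_centers d.+1 k (D + delta)) delta v) (i, ord0)|.
  move=> ij; apply: le_trans (ler_norm _).
  rewrite !entry_cube_vertex /entry !tnth_mktuple.
  have : (i.+1%:R * (D + delta) <= j%:R * (D + delta) :> R).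
    by rewrite ler_wpM2r ?ler_nat ?addr_ge0.
  rewrite mulrSr mulrDl mul1r.
  have /andP[a0 a1] : 0 <= delta * (v (j, ord0))%:R <= delta.
    by case: (v _); rewrite ?mulr1 ?mulr0 lexx ?delta0.
  have /andP[b0 b1] : 0 <= delta * (v (i, ord0))%:R <= delta.
    by case: (v _); rewrite ?mulr1 ?mulr0 lexx ?delta0.
  lra.
move=> i j ij; apply: le_trans (le_eucl_dist _ _ ord0).
move: ij; rewrite -val_eqE neq_ltn => /orP[ij|ji].
  by rewrite distrC; exact: far.
exact: far.
Qed.

Theorem proposition6p5 (R : realType) :
  exists2 c : R, 0 < c &
    forall (d k n : nat) (D rho : R),
      (0 < k)%N -> (k < d)%N -> (0 < n)%N ->
      0 < D -> 0 < rho -> rho <= 1 ->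
      ((c * (d%:R * k%:R ^+ 2 / n%:R))%:E <= minimax_risk d k n D rho)%E.
Proof.
exists 4^-1 => // d k n D rho k0 kd n0 D0 rho0 _.
apply: le_ereal_inf_tmp => _ [est _ <-].
(* [delta ^ 2 = 2 k / n] maximizes [delta ^ 2 * (k - delta ^ 2 / 4 * n)]. *)
pose delta : R := Num.sqrt (2 * k%:R / n%:R).
have delta2 : delta ^+ 2 = 2 * k%:R / n%:R.
  by rewrite sqr_sqrtr// divr_ge0// mulr_ge0.
have n_neq0 : n%:R != 0 :> R by rewrite pnatr_eq0 -lt0n.
pose theta := spread_centers d k (D + delta).
set B := 4^-1 * _; set S : \bar R := ereal_sup _.
have BE : delta ^+ 2 / 4 * d%:R * (k%:R - delta ^+ 2 / 4 * n%:R) = B.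
  by rewrite delta2 /B; field.
have B0 : 0 <= B by rewrite /B !mulr_ge0// ?invr_ge0// exprn_ge0.
have riskS v : (risk rho est (cube_vertex theta delta v) <= S)%E.
  apply: ereal_sup_ubound; exists (cube_vertex theta delta v) => //.
  by apply: separated_cube; [exact: leq_trans kd|exact: ltW|exact: sqrtr_ge0].
have := @sum_cube_risk R d k n theta delta rho est k0 (lt0r_neq0 rho0).
rewrite BE => /(_ (measurable_funPT est) B0).
clearbody S.
move=> /le_trans/(_ (lee_sum _ (fun v _ => riskS v))).
rewrite sumr_const -[(S *+ _)%R]mule_natl EFinM lee_pmul2l// lte_fin ltr0n.
by apply/card_gt0P; exists [ffun=> false].
Qed.
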